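(* There is no shuffling method $\Sigma$ such that $S_n(\mathrm{St}) = S_n(\mathbb{Q}_{\Sigma})$ for every $n\ge 1$, where $\mathrm{St}$ is the stack and $\mathbb{Q}_{\Sigma}$ is the shuffle queue of $\Sigma$.
   Context: Permutations of size $n$ are bijections of $[n]=\{1,\dots,n\}$, written in one-line notation; $S_n$ is the set of all of them, $id_n=12\cdots n$, and $\varepsilon$ is the empty sequence. A sorting device processes configurations $(s_{inp},s_{dev},s_{out})$ of three sequences (current input, content of the device, output), starting from $(\pi,\varepsilon,\varepsilon)$ and ending at $(\varepsilon,\varepsilon,\pi')$; $\pi'$ is then called a possible output on input $\pi$. For a device $\mathbb{D}$, $S_n(\mathbb{D})$ is the set of $\pi\in S_n$ for which $id_n$ is a possible output on input $\pi$ (the operations are chosen freely). Stack ($\mathrm{St}$): the content is a list; an input operation removes the first element of the input and inserts it at a fixed end of the list, and an output operation removes the element at that same end and appends it to the end of the output. A shuffling method $\Sigma$ is a family of sets $\Pi_{\Sigma}^{n}\subseteq S_n$, $n\ge 2$, with $id_n\notin \Pi_{\Sigma}^{n}$ for all $n\geq 2$. The shuffle queue $\mathbb{Q}_{\Sigma}$ has the operations: push (move the first element of the input to the end of $s_{dev}$); pop (move the first element of $s_{dev}$ to the end of the output); shuffle (if $s_{dev}=s_1\cdots s_m$ with $m\ge 2$, choose $\sigma\in\Pi_{\Sigma}^{m}$ and replace $s_{dev}$ by $s_{\sigma(1)}s_{\sigma(2)}\cdots s_{\sigma(m)}$). A shuffle may not be applied immediately after another shuffle. *)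

(* Defs.v *)
From mathcomp Require Import all_boot all_fingroup.

Set Implicit Arguments.
Unset Strict Implicit.
Unset Printing Implicit Defensive.

(* A permutation of [n] = {1, ..., n} is encoded by pi : 'S_n, acting on
   {0, ..., n-1}; values are shifted by one in its one-line notation. *)
Definition one_line (n : nat) (pi : 'S_n) : seq nat :=
  [seq (val (pi i)).+1 | i <- enum 'I_n].

(* (input, content of the device, output) *)
Definition config : Type := (seq nat * seq nat * seq nat)%type.

(* [dev_follow a b] says that operation b may be applied immediately after
   operation a. *)
Record device : Type := Device {
  dev_op : Type;
  dev_step : dev_op -> config -> config -> Prop;
  dev_follow : rel dev_op
}.

Inductive dev_run (D : device) : config -> seq (dev_op D) -> config -> Prop :=
| run_nil c : dev_run c [::] c
| run_cons a ops c1 c2 c3 :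
    dev_step a c1 c2 -> dev_run c2 ops c3 -> dev_run c1 (a :: ops) c3.

(* [sorted r ops] only compares consecutive elements of ops. *)
Definition possible_output (D : device) (s s' : seq nat) : Prop :=
  exists ops : seq (dev_op D),
    sorted (@dev_follow D) ops /\
    dev_run (s, [::], [::]) ops ([::], [::], s').

(* pi \in S_n(D) *)
Definition sortable (D : device) (n : nat) (pi : 'S_n) : Prop :=
  possible_output D (one_line pi) (one_line (1%g : 'S_n)).

Inductive stack_op : Type := StInput | StOutput.

(* The top of the stack is the head of the list. *)
Inductive stack_step : stack_op -> config -> config -> Prop :=
| stack_input x i s o : stack_step StInput (x :: i, s, o) (i, x :: s, o)
| stack_output x i s o : stack_step StOutput (i, x :: s, o) (i, s, rcons o x).

Definition stack : device := Device stack_step (fun _ _ => true).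

(* The components of index 0 and 1 are irrelevant: they are neither
   constrained nor used by the shuffle queue. *)
Record shuffling_method : Type := ShufflingMethod {
  shuffles :> forall n : nat, {set 'S_n};
  shuffles_id : forall n : nat, 2 <= n -> (1%g : 'S_n) \notin shuffles n
}.

Inductive queue_op : Type := QPush | QPop | QShuffle.

Definition is_shuffle (a : queue_op) : bool :=
  if a is QShuffle then true else false.

(* s_(sigma(1)) s_(sigma(2)) ... s_(sigma(m)) *)
Definition shuffle_seq (s : seq nat) (sigma : 'S_(size s)) : seq nat :=
  [seq nth 0 s (sigma i) | i <- enum 'I_(size s)].

Inductive queue_step (Sigma : shuffling_method) :
    queue_op -> config -> config -> Prop :=
| queue_push x i s o :
    queue_step Sigma QPush (x :: i, s, o) (i, rcons s x, o)
| queue_pop x i s o :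
    queue_step Sigma QPop (i, x :: s, o) (i, s, rcons o x)
| queue_shuffle i s o (sigma : 'S_(size s)) :
    2 <= size s -> sigma \in Sigma (size s) ->
    queue_step Sigma QShuffle (i, s, o) (i, shuffle_seq sigma, o).

Definition shuffle_queue (Sigma : shuffling_method) : device :=
  Device (queue_step Sigma) (fun a b => ~~ (is_shuffle a && is_shuffle b)).

(* Main.v *)
Require Import Defs.
From mathcomp Require Import all_boot all_fingroup.

(** The obstruction already appears for permutations of size 3.  The stack
    sorts 21, so the shuffle queue must contain the only non-identity shuffle
    of two elements ([shuffle2_of_swapped_output]) and can exchange two
    elements whenever they are its whole content ([shuffle_pair]).  But then
    it cannot tell the input x y ... from the input y x ... when neither x nor
    y may leave first: nothing can be popped while the content consists of x
    and y, so each of the two inputs can bring the device to content x y as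
    well as to content y x just before a third push, and the configuration
    determines what can follow that push ([queue_output_swap]).  Hence if 321
    is sortable by the shuffle queue then so is 231, whereas the stack sorts
    321 and does not sort 231 ([stack_avoids_231]). *)

(** * Runs, one operation at a time *)

Lemma dev_run_inv (D : device) c1 (ops : seq (dev_op D)) c3 :
  dev_run c1 ops c3 ->
  if ops is a :: ops' then
    exists2 c2, dev_step a c1 c2 & dev_run c2 ops' c3
  else c1 = c3.
Proof. by case=> [c|a ops' d1 d2 d3 st run] //; exists d2. Qed.

(** Output is never withdrawn, so a run can be discarded as soon as its output
    disagrees with the target. *)
Lemma dev_run_output_prefix (D : device) :
    (forall (a : dev_op D) c1 c2, dev_step a c1 c2 -> prefix c1.2 c2.2) ->
  forall c1 (ops : seq (dev_op D)) c2, dev_run c1 ops c2 -> prefix c1.2 c2.2.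
Proof.
move=> step_prefix c1 ops c2.
elim=> [c|a ops' d1 d2 d3 /step_prefix le12 _ le23]; first exact: prefix_refl.
exact: prefix_trans le12 le23.
Qed.

(** The prefix condition at each output operation is what makes the case
    analyses below short: it removes every output that the target forbids. *)
Variant stack_run_spec (i s o o' : seq nat) : seq stack_op -> Prop :=
| StackRunEnd of i = [::] & s = [::] : stack_run_spec i s o o' [::]
| StackRunInput x i' ops of i = x :: i'
    & @dev_run stack (i', x :: s, o) ops ([::], [::], o') :
    stack_run_spec i s o o' (StInput :: ops)
| StackRunOutput x s' ops of s = x :: s' & prefix (rcons o x) o'
    & @dev_run stack (i, s', rcons o x) ops ([::], [::], o') :
    stack_run_spec i s o o' (StOutput :: ops).

Lemma stack_runP i s o ops o' :
  @dev_run stack (i, s, o) ops ([::], [::], o') -> stack_run_spec i s o o' ops.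
Proof.
have out_prefix := @dev_run_output_prefix stack.
case: ops => [|a ops] /dev_run_inv; first by case=> -> -> _; apply: StackRunEnd.
case=> c2 st run.
have {out_prefix} : prefix c2.2 o'.
  by apply: (out_prefix _ c2 ops _ run) => b d1 d2 [] *;
    rewrite ?prefix_refl ?prefix_rcons.
by inversion st; subst => /= ?; [apply: StackRunInput | apply: StackRunOutput].
Qed.

Variant queue_run_spec (Sigma : shuffling_method) (i s o o' : seq nat) :
  seq queue_op -> Prop :=
| QueueRunEnd of i = [::] & s = [::] : queue_run_spec Sigma i s o o' [::]
| QueueRunPush x i' ops of i = x :: i'
    & @dev_run (shuffle_queue Sigma) (i', rcons s x, o) ops ([::], [::], o') :
    queue_run_spec Sigma i s o o' (QPush :: ops)
| QueueRunPop x s' ops of s = x :: s' & prefix (rcons o x) o'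
    & @dev_run (shuffle_queue Sigma) (i, s', rcons o x) ops ([::], [::], o') :
    queue_run_spec Sigma i s o o' (QPop :: ops)
| QueueRunShuffle (sigma : 'S_(size s)) ops of 2 <= size s
    & sigma \in Sigma (size s)
    & @dev_run (shuffle_queue Sigma) (i, shuffle_seq sigma, o) ops
        ([::], [::], o') :
    queue_run_spec Sigma i s o o' (QShuffle :: ops).

Lemma queue_runP Sigma i s o ops o' :
  @dev_run (shuffle_queue Sigma) (i, s, o) ops ([::], [::], o') ->
  queue_run_spec Sigma i s o o' ops.
Proof.
have out_prefix := @dev_run_output_prefix (shuffle_queue Sigma).
case: ops => [|a ops] /dev_run_inv; first by case=> -> -> _; apply: QueueRunEnd.
case=> c2 st run.
have {out_prefix} : prefix c2.2 o'.
  by apply: (out_prefix _ c2 ops _ run) => b d1 d2 [] *;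
    rewrite ?prefix_refl ?prefix_rcons.
inversion st; subst => /= ?.
- exact: QueueRunPush.
- exact: QueueRunPop.
- exact: (@QueueRunShuffle _ _ _ _ _ sigma).
Qed.

(** * The stack *)

Lemma stack_sorts_21 x y : possible_output stack [:: x; y] [:: y; x].
Proof.
exists [:: StInput; StInput; StOutput; StOutput]; split=> //.
by do !(econstructor; first exact: stack_input || exact: stack_output);
  constructor.
Qed.

Lemma stack_sorts_321 x y z : possible_output stack [:: x; y; z] [:: z; y; x].
Proof.
exists [:: StInput; StInput; StInput; StOutput; StOutput; StOutput].
split=> //.
by do !(econstructor; first exact: stack_input || exact: stack_output);
  constructor.
Qed.

(** The element x has to leave first, so all three elements enter before any
    output, and then z lies above y. *)
Lemma stack_avoids_231 x y z : uniq [:: x; y; z] ->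
  ~ possible_output stack [:: y; z; x] [:: x; y; z].
Proof.
rewrite /= !inE negb_or => /and3P[/andP[/negPf neq_xy /negPf neq_xz]].
move=> /negPf neq_yz _ [ops [_ run]].
case: (stack_runP _ _ _ _ _ run) => // _ _ {}ops [<- <-] {}run.
case: (stack_runP _ _ _ _ _ run) => {ops run}//.
  move=> _ _ ops [<- <-] run.
  case: (stack_runP _ _ _ _ _ run) => {ops run}//.
    move=> _ _ ops [<- <-] run.
    case: (stack_runP _ _ _ _ _ run) => {ops run}// _ _ ops [<- <-] _ run.
    case: (stack_runP _ _ _ _ _ run) => {ops run}// _ _ ops [<- <-] /=.
    by rewrite eqxx eq_sym neq_yz.
  by move=> w s ops [<- _] /=; rewrite eq_sym neq_xz.
by move=> w s ops [<- _] /=; rewrite eq_sym neq_xy.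
Qed.

(** * Shuffling two elements *)

Lemma enum_ord2 : enum 'I_2 = [:: ord0; ord_max].
Proof. by apply: (inj_map val_inj); rewrite val_enum_ord. Qed.

Lemma shuffle_pair (x y : nat) (sigma : 'S_(size [:: x; y])) :
  sigma != 1%g -> shuffle_seq sigma = [:: y; x].
Proof.
move: sigma; rewrite /shuffle_seq /= => sigma nontriv.
have sigma_inj : sigma ord0 != sigma ord_max by rewrite (inj_eq perm_inj).
have sigma0 : sigma ord0 != ord0.
  apply: contraNneq nontriv => sigma0; rewrite sigma0 in sigma_inj.
  apply/eqP/permP => i; rewrite perm1.
  have ordP (j : 'I_2) : j = if j == ord0 then ord0 else ord_max.
    by case: j => [[|[|]]] // ?; apply/val_inj.
  rewrite [i]ordP; case: ifP => // _.
  by rewrite [LHS]ordP eq_sym (negPf sigma_inj).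
move: sigma_inj sigma0; rewrite enum_ord2 /= -!val_eqE /=.
by case: (sigma ord0) => [[|[|]]] //; case: (sigma ord_max) => [[|[|]]].
Qed.

Section ShuffleQueue.

Variable Sigma : shuffling_method.

(** Without a shuffle the queue would preserve the order, and y leaves only
    after x and y have both entered, so the first shuffle acts on two
    elements. *)
Lemma shuffle2_of_swapped_output x y : x != y ->
    possible_output (shuffle_queue Sigma) [:: x; y] [:: y; x] ->
  exists sigma, sigma \in Sigma 2.
Proof.
move=> /negPf neq_xy [ops [_ run]].
have no_x_first : prefix [:: x] [:: y; x] = false by rewrite /= neq_xy.
case: (queue_runP _ _ _ _ _ _ run) => {ops run}// _ _ ops [<- <-] run.
case: (queue_runP _ _ _ _ _ _ run) => {ops run}//; last first.
  by move=> w s ops [<- _]; rewrite no_x_first.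
move=> _ _ ops [<- <-] run.
case: (queue_runP _ _ _ _ _ _ run) => {ops run}//; last first.
  by move=> sigma _ _ sigma_in _; exists sigma.
by move=> w s ops [<- _]; rewrite no_x_first.
Qed.

(** Until the third push, the content x y and the content y x can be turned
    into each other: a run from one input is imitated on the other by
    performing a shuffle before that push exactly when the given run does
    not.  The ban on consecutive shuffles leaves no other possibility. *)
Lemma queue_output_swap tau x y i z o :
    tau \in Sigma 2 -> z \notin [:: x; y] ->
    possible_output (shuffle_queue Sigma) [:: x, y & i] (z :: o) ->
  possible_output (shuffle_queue Sigma) [:: y, x & i] (z :: o).
Proof.
move=> tau_in; rewrite !inE negb_or => /andP[neq_zx neq_zy] [ops [follow run]].
have no_first u s : u != z -> prefix (u :: s) (z :: o) = false.
  by move=> /negPf /= ->.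
have no_x s : prefix (x :: s) (z :: o) = false by rewrite no_first // eq_sym.
have no_y s : prefix (y :: s) (z :: o) = false by rewrite no_first // eq_sym.
have swap u v (sigma : 'S_(size [:: u; v])) :
    sigma \in Sigma 2 -> shuffle_seq sigma = [:: v; u].
  by move=> sigma_in; apply/shuffle_pair/(contraTneq _ sigma_in) => ->;
    apply: shuffles_id.
case: (queue_runP _ _ _ _ _ _ run) follow => {ops run}//.
move=> _ _ ops [<- <-] run follow.
case: (queue_runP _ _ _ _ _ _ run) follow => {ops run}//; last first.
  by move=> w s ops [<- _]; rewrite no_x.
move=> _ _ ops [<- <-] run follow.
case: (queue_runP _ _ _ _ _ _ run) follow => {ops run}//.
- move=> w i' ops def_i run follow.
  exists [:: QPush, QPush, QShuffle, QPush & ops]; split=> //.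
  econstructor; first exact: queue_push.
  econstructor; first exact: queue_push.
  econstructor; first exact: (@queue_shuffle Sigma _ [:: y; x] _ tau).
  rewrite swap // def_i; econstructor; [exact: queue_push | exact: run].
- by move=> w s ops [<- _]; rewrite no_x.
move=> sigma ops _ sigma_in; rewrite swap // => run follow.
case: (queue_runP _ _ _ _ _ _ run) follow => {ops run}//.
- move=> w i' ops def_i run follow.
  exists [:: QPush, QPush, QPush & ops]; split=> //.
  econstructor; first exact: queue_push.
  econstructor; first exact: queue_push.
  rewrite def_i; econstructor; [exact: queue_push | exact: run].
by move=> w s ops [<- _]; rewrite no_y.
Qed.

End ShuffleQueue.

(** * One-line notations *)

Lemma one_line_perm n (f : 'I_n -> 'I_n) (f_inj : injective f) :
  one_line (perm f_inj) = [seq (val (f i)).+1 | i <- enum 'I_n].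
Proof. by apply: eq_map => i; rewrite permE. Qed.

Lemma one_line_id n : one_line (1%g : 'S_n) = iota 1 n.
Proof.
have -> : one_line (1%g : 'S_n) = map (addn 1) (map val (enum 'I_n)).
  by rewrite -map_comp; apply: eq_map => i; rewrite /= perm1.
by rewrite val_enum_ord -iotaDl.
Qed.

Lemma enum_ord3 : enum 'I_3 = [:: ord0; inord 1; ord_max].
Proof. by apply: (inj_map val_inj); rewrite val_enum_ord /= inordK. Qed.

Theorem theorem2p4 :
  ~ exists Sigma : shuffling_method,
      forall n : nat, 1 <= n ->
        forall pi : 'S_n, sortable stack pi <-> sortable (shuffle_queue Sigma) pi.
Proof.
case=> Sigma same_sortable.
have [tau tau_in] : exists sigma, sigma \in Sigma 2.
  apply: (@shuffle2_of_swapped_output _ 2 1) => //.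
  have := same_sortable 2 isT (perm (@rev_ord_inj 2)).
  rewrite /sortable one_line_perm one_line_id enum_ord2 /= => -[stack_queue _].
  exact/stack_queue/stack_sorts_21.
have queue_sorts_321 :
    possible_output (shuffle_queue Sigma) [:: 3; 2; 1] [:: 1; 2; 3].
  have := same_sortable 3 isT (perm (@rev_ord_inj 3)).
  rewrite /sortable one_line_perm one_line_id enum_ord3 /= inordK //.
  by move=> -[stack_queue _]; exact/stack_queue/stack_sorts_321.
have := same_sortable 3 isT (perm (@ordS_inj 3)).
rewrite /sortable one_line_perm one_line_id enum_ord3 /= inordK //.
(* The cyclic successor on three points has one-line notation 231. *)
move=> -[_ queue_stack]; apply: (@stack_avoids_231 1 2 3) => //.
by apply/queue_stack/(@queue_output_swap _ tau).
Qed.
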